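(* Let $N>2+2\sqrt2$ and let $\gamma_n\in \mathrm{CDA}_n^{\mathcal U}$. Then for every $\epsilon>0$ there exists $\delta>0$ such that for every $\eta_n\in \mathrm{CDA}_n^{\mathcal U}$: $$d(\gamma_n,\eta_n)\le\delta\quad\Longrightarrow\quad h(V(\gamma_n),V(\eta_n))\le\epsilon,$$ where $h$ is the Hausdorff distance between the one-skeletons $V(\gamma_n)$ and $V(\eta_n)$ of the Voronoi diagrams of $\gamma_n$ and $\eta_n$.
   Context: For $m\geq 2$, let $\mathrm{CONF}_m=\{(p_1,\dots,p_m)\in(\mathbb{R}^2)^m : p_i\ne p_j \text{ for } i\neq j\}$. For distinct points $p_i,p_j$ let $\alpha_{ij}\in\mathbb{R}/2\pi\mathbb{Z}$ be the argument of $p_j-p_i$. Let $\mathrm{CDA}_m$ be the closure in $(\mathbb{R}^2)^m\times(\mathbb{R}/2\pi\mathbb{Z})^{\binom m2}$ of the graph of $(p_1,\dots,p_m)\mapsto(\alpha_{ij})_{1\le i<j\le m}$ on $\mathrm{CONF}_m$. For an element of $\mathrm{CDA}_m$ with points $p_i$ (not necessarily distinct) and angles $\alpha_{ij}$ ($i<j$), put $\alpha_{ji}=\alpha_{ij}+\pi$. Let $\mathcal U=\{x\in\mathbb{R}^2:\|x\|\le1\}$, and let the camera points be $c_1=(-N,0)$, $c_2=(0,N)$, $c_3=(N,0)$, $c_4=(0,-N)$. $\mathrm{CDA}_n^{\mathcal U}$ is the set of elements of $\mathrm{CDA}_{n+4}$ whose $n+4$ points are $c_1,\dots,c_4,p_1,\dots,p_n$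 with $p_1,\dots,p_n\in\mathcal U$ (together with the $\binom{n+4}{2}$ angles). Voronoi diagram of such data with points $q_1,\dots,q_{n+4}$ and angles $\alpha_{ij}$: for $i\ne j$ let $vh(q_i,q_j)=\{z\in\mathbb{R}^2:(\cos\alpha_{ij},\sin\alpha_{ij})\cdot(z-\tfrac12(q_i+q_j))\le0\}$ and $V(q_i)=\bigcap_{j\ne i}vh(q_i,q_j)$. The one-skeleton is the union of the topological boundaries of the cells $V(q_i)$, and $V(\gamma_n)$ denotes this one-skeleton for the data set $\gamma_n$. The distance $d$ on data sets is the maximum of all Euclidean distances between corresponding points and all distances in $\mathbb{R}/2\pi\mathbb{Z}$ between corresponding angles. The Hausdorff distance of $A,B\subset\mathbb{R}^2$ is $h(A,B)=\inf\{r>0: A\subset N_r(B),\ B\subset N_r(A)\}$, where $N_r(A)$ is the open $r$-neighbourhood of $A$. *)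

(* Defs.v *)
From HB Require Import structures.
From mathcomp Require Import all_boot all_order all_algebra.
From mathcomp Require Import all_classical all_reals all_analysis.

Set Implicit Arguments.
Unset Strict Implicit.
Unset Printing Implicit Defensive.

Import Order.TTheory GRing.Theory Num.Theory.
Import numFieldNormedType.Exports.

Local Open Scope classical_set_scope.
Local Open Scope ring_scope.
Local Open Scope quotient_scope.

Definition two_pi_int (R : realType) : {pred R} :=
  [pred x : R | `[< exists k : int, x = k%:~R * (2 * pi) >]].

Lemma two_pi_int_zmod_closed (R : realType) : zmod_closed (@two_pi_int R).
Proof.
split=> [|x y]; first by apply/asboolP; exists 0; rewrite mul0r.
move=> /asboolP[k ->] /asboolP[l ->]; apply/asboolP; exists (k - l).
by rewrite intrB mulrBl.
Qed.

HB.instance Definition _ (R : realType) :=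
  GRing.isZmodClosed.Build R (@two_pi_int R) (@two_pi_int_zmod_closed R).

(* R / 2 pi Z, with the quotient group structure and the quotient topology. *)
Definition angle (R : realType) : Type :=
  quotient_topology (Quotient.quot (@two_pi_int R)).

HB.instance Definition _ (R : realType) := Topological.on (angle R).
HB.instance Definition _ (R : realType) := Quotient.on (angle R).
HB.instance Definition _ (R : realType) :=
  GRing.Zmodule.copy (angle R) (Quotient.quot (@two_pi_int R)).

Definition angle_of (R : realType) (x : R) : angle R := \pi_(angle R) x.

Lemma angle_ofD (R : realType) (x y : R) :
  angle_of (x + y) = angle_of x + angle_of y.
Proof. exact: (@Quotient.pi_add R (@two_pi_int R)). Qed.

Lemma angle_ofN (R : realType) (x : R) : angle_of (- x) = - angle_of x.
Proof. exact: (@Quotient.pi_opp R (@two_pi_int R)). Qed.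

Lemma angle_of_continuous (R : realType) : continuous (@angle_of R).
Proof. exact: pi_continuous. Qed.

Lemma angle_of_eqP (R : realType) (x y : R) :
  angle_of x = angle_of y <-> exists k : int, x = y + k%:~R * (2 * pi).
Proof.
have E := @eqquotP R (Quotient.equiv_equiv (@two_pi_int R))
  (Quotient.quot (@two_pi_int R)) x y.
split=> [/E/asboolP[k xy]|[k xy]]; first by exists k; rewrite -xy addrC subrK.
by apply/E/asboolP; exists k; rewrite xy addrC addKr.
Qed.

(* repr picks an arbitrary representative; cos_angle_of and sin_angle_of show
   that the choice is irrelevant. *)
Definition cos_angle (R : realType) (a : angle R) : R := cos (repr a).
Definition sin_angle (R : realType) (a : angle R) : R := sin (repr a).

Lemma periodic_int (R : realType) (f : R -> R) (k : int) (x : R) :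
  (forall y, f (y + 2 * pi) = f y) -> f (x + k%:~R * (2 * pi)) = f x.
Proof.
move=> fP; have fn n y : f (y + n%:R * (2 * pi)) = f y.
  elim: n y => [|n IH] y; first by rewrite mul0r addr0.
  by rewrite -[n.+1]addn1 natrD mulrDl mul1r addrA fP IH.
case: k => n; first exact: fn.
by rewrite NegzE mulrNz mulNr -(fn n.+1) subrK.
Qed.

Lemma repr_angle_of (R : realType) (x : R) :
  exists k : int, repr (angle_of x) = x + k%:~R * (2 * pi).
Proof. by apply/angle_of_eqP; exact: reprK. Qed.

Lemma cos_angle_of (R : realType) (x : R) : cos_angle (angle_of x) = cos x.
Proof.
rewrite /cos_angle; have [k ->] := repr_angle_of x.
by apply: periodic_int => y; rewrite mulr_natl cosD2pi.
Qed.

Lemma sin_angle_of (R : realType) (x : R) : sin_angle (angle_of x) = sin x.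
Proof.
rewrite /sin_angle; have [k ->] := repr_angle_of x.
by apply: periodic_int => y; rewrite mulr_natl sinD2pi.
Qed.

Definition angle_dist (R : realType) (a b : angle R) : R :=
  inf [set `|x| | x in [set x : R | angle_of x = a - b]].

(* The norm that the library puts on R * R is the sup norm, hence the explicit
   Euclidean norm. The product topology is the Euclidean one. *)
Definition norm2 (R : realType) (v : R * R) : R :=
  Num.sqrt (v.1 ^+ 2 + v.2 ^+ 2).

Definition dot (R : realType) (v w : R * R) : R := v.1 * w.1 + v.2 * w.2.

Definition direction (R : realType) (a : angle R) : R * R :=
  (cos_angle a, sin_angle a).

Definition is_argument (R : realType) (v : R * R) (a : angle R) : Prop :=
  v = norm2 v *: direction a.

Definition pairs (m : nat) : Type :=
  {ij : 'I_m * 'I_m | (ij.1 < ij.2)%N}.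

HB.instance Definition _ (m : nat) := Finite.on (pairs m).

Definition data (R : realType) (m : nat) : Type :=
  ({ptws 'I_m -> (R * R)%type} * {ptws pairs m -> angle R})%type.

HB.instance Definition _ (R : realType) (m : nat) := Topological.on (data R m).

Definition point_of (R : realType) (m : nat) (x : data R m) (i : 'I_m) : R * R :=
  x.1 i.

Definition CONF (R : realType) (m : nat) : set ('I_m -> R * R) :=
  [set p | forall i j, i != j -> p i != p j].

Definition arg_graph (R : realType) (m : nat) : set (data R m) :=
  [set x | CONF (point_of x) /\
     forall ij : pairs m,
       is_argument (point_of x (val ij).2 - point_of x (val ij).1) (x.2 ij)].

Definition CDA (R : realType) (m : nat) : set (data R m) :=
  closure (@arg_graph R m).

(* alpha_ij for i < j, extended by alpha_ji = alpha_ij + pi; the value 0 on the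
   diagonal is never used. *)
Definition alpha (R : realType) (m : nat) (x : data R m) (i j : 'I_m) : angle R :=
  if insub (i, j) is Some ij then x.2 ij
  else if insub (j, i) is Some ji then x.2 ji + angle_of pi
  else 0.

Definition camera (R : realType) (N : R) (k : 'I_4) : R * R :=
  tnth [tuple (- N, 0); (0, N); (N, 0); (0, - N)] k.

Definition CDA_U (R : realType) (N : R) (n : nat) : set (data R (4 + n)) :=
  [set x | [/\ CDA x,
     forall k : 'I_4, point_of x (lshift n k) = camera N k &
     forall i : 'I_n, norm2 (point_of x (rshift 4 i)) <= 1]].

Definition vh (R : realType) (m : nat) (x : data R m) (i j : 'I_m) :
    set (R * R) :=
  [set z | dot (direction (alpha x i j))
             (z - 2^-1 *: (point_of x i + point_of x j)) <= 0].

Definition voronoi_cell (R : realType) (m : nat) (x : data R m) (i : 'I_m) :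
    set (R * R) :=
  \bigcap_(j in [set j | j != i]) vh x i j.

Definition boundary (T : topologicalType) (A : set T) : set T :=
  closure A `\` interior A.

Definition skeleton (R : realType) (m : nat) (x : data R m) : set (R * R) :=
  \bigcup_i boundary (voronoi_cell x i).

Definition data_dist (R : realType) (m : nat) (x y : data R m) : R :=
  Num.max (\big[Num.max/0]_(i < m) norm2 (point_of x i - point_of y i))
          (\big[Num.max/0]_(ij : pairs m) angle_dist (x.2 ij) (y.2 ij)).

Definition nbhd (R : realType) (r : R) (A : set (R * R)) : set (R * R) :=
  [set z | exists2 a, A a & norm2 (z - a) < r].

(* Extended-real valued: the infimum of the empty set is +oo. *)
Definition hausdorff_dist (R : realType) (A B : set (R * R)) : \bar R :=
  ereal_inf [set r%:E | r in
    [set r : R | [/\ 0 < r, A `<=` nbhd r B & B `<=` nbhd r A]]].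

(* Main.v *)
Require Import Defs.
From mathcomp Require Import all_boot all_order all_algebra.
From mathcomp Require Import all_classical all_reals all_analysis.
From mathcomp Require Import ring lra.
Import Order.TTheory GRing.Theory Num.Theory.
Import numFieldNormedType.Exports.
Local Open Scope classical_set_scope.
Local Open Scope ring_scope.

(* Write sdist x i j z for the signed distance from z to the bisector of the
   points i and j, so that z lies in the cell of i iff sdist x i j z <= 0 for
   all j != i.  If z is on the skeleton of x then every i has some j != i with
   sdist x i j z >= 0.  Conversely, suppose every i has some j != i with
   sdist y i j z > - s.  The cells of y cover the plane, because this property
   passes from honest configurations to limits, so z lies in some cell i;
   moving z by s along the direction alpha_ij leaves that cell, and the segment
   meets its boundary.  Hence the skeleton of y has a point within s of z.
   It remains to compare sdist x and sdist y.  On a bounded square they are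
   uniformly close when the data are.  Outside the square some camera is nearer
   to z than every point of the unit disk, so only the bisectors between
   cameras matter, and these are common to x and y. *)

(** * Signed distances and the Euclidean norm *)

Definition sdist {R : realType} {m : nat} (x : data R m) (i j : 'I_m)
    (z : R * R) : R :=
  dot (direction (alpha x i j)) (z - 2^-1 *: (point_of x i + point_of x j)).

Definition sqdist {R : realType} (z w : R * R) : R :=
  (z.1 - w.1) ^+ 2 + (z.2 - w.2) ^+ 2.

Lemma norm2_ge0 {R : realType} (v : R * R) : 0 <= norm2 v.
Proof. exact: sqrtr_ge0. Qed.

Lemma norm2_eq0 {R : realType} (v : R * R) : norm2 v = 0 -> v = 0.
Proof.
case: v => a b /eqP; rewrite /norm2 /= sqrtr_eq0 => ab.
have a0 := sqr_ge0 a; have b0 := sqr_ge0 b.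
have /eqP : a ^+ 2 = 0 by lra.
have /eqP : b ^+ 2 = 0 by lra.
by rewrite !expf_eq0 /= => /eqP -> /eqP ->.
Qed.

Lemma coord_le_norm2 {R : realType} (v : R * R) :
  `|v.1| <= norm2 v /\ `|v.2| <= norm2 v.
Proof.
rewrite /norm2 -!sqrtr_sqr.
by split; apply: ler_wsqrtr; rewrite ?lerDl ?lerDr sqr_ge0.
Qed.

Lemma dot_direction {R : realType} (a : angle R) :
  dot (direction a) (direction a) = 1.
Proof. by rewrite /dot /= -!expr2 /cos_angle /sin_angle cos2Dsin2. Qed.

Lemma norm2_direction {R : realType} (t : R) (a : angle R) :
  norm2 (t *: direction a) = `|t|.
Proof.
rewrite /norm2 /= !exprMn -mulrDr.
by rewrite (cos2Dsin2 (repr a : R)) mulr1 sqrtr_sqr.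
Qed.

(** * Continuity in the data and in the point of the plane *)

(** By the universal property of the quotient topology, continuity may be tested after composing
    with [angle_of], which gives back [cos] and [sin]. *)
Lemma direction_continuous {R : realType} : continuous (@direction R).
Proof.
have cq (f : angle R -> R) g : continuous g ->
    (forall x, f (angle_of x) = g x) -> continuous f.
  move=> gc fg; apply/quotient_continuous.
  rewrite (_ : f \o _ = g) //; apply/funext => x; exact: fg.
have cc := cq _ _ (@continuous_cos R) (@cos_angle_of R).
have sc := cq _ _ (@continuous_sin R) (@sin_angle_of R).
move=> a; exact: (@cvg_pair _ _ _ (nbhs a) (nbhs (cos_angle a))
  (nbhs (sin_angle a)) _ _ _ _ _ (cc a) (sc a)).
Qed.

Lemma point_of_continuous {R : realType} {m : nat} (i : 'I_m) :
  continuous (fun x : data R m => point_of x i).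
Proof.
move=> x; apply: (@continuous_comp _ _ _ (fun x : data R m => x.1)
  (fun p : {ptws 'I_m -> (R * R)%type} => p i)); first exact: cvg_fst.
exact: (@proj_continuous _ (fun=> (R * R)%type) i).
Qed.

Lemma direction_angle_continuous {R : realType} {m : nat} (ij : pairs m) :
  continuous (fun x : data R m => direction (x.2 ij)).
Proof.
move=> x; apply: continuous_comp; last exact: direction_continuous.
apply: (@continuous_comp _ _ _ (fun x : data R m => x.2)
  (fun p : {ptws pairs m -> angle R} => p ij)); first exact: cvg_snd.
exact: (@proj_continuous _ (fun=> angle R) ij).
Qed.

(** Angles are stored for increasing pairs only; in the reversed order the added [pi] negates both
    coordinates. *)
Lemma direction_alpha {R : realType} {m : nat} (x : data R m) (ij : pairs m) :
  direction (alpha x (val ij).1 (val ij).2) = direction (x.2 ij) /\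
  direction (alpha x (val ij).2 (val ij).1) = - direction (x.2 ij).
Proof.
rewrite /alpha -!surjective_pairing valK; case: ij => -[i j] /= lij.
rewrite insubF /=; last by rewrite ltnNge ltnW.
split=> //.
set a := x.2 _.
have -> : a = angle_of (repr a) by rewrite /angle_of reprK.
rewrite -angle_ofD /direction.
by rewrite !cos_angle_of !sin_angle_of cosDpi sinDpi.
Qed.

(** Reduces claims about two distinct indices to a stored pair read in one of its two orders. *)
Lemma neq_pairs {m : nat} (i j : 'I_m) : i != j ->
  exists ij : pairs m, (i = (val ij).1 /\ j = (val ij).2) \/
                       (i = (val ij).2 /\ j = (val ij).1).
Proof.
rewrite neq_ltn => /orP[] h; [exists (Sub (i, j) h)|exists (Sub (j, i) h)];
  rewrite SubK; by [left|right].
Qed.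

Lemma direction_alphaN {R : realType} {m : nat} (x : data R m) (i j : 'I_m) :
  i != j -> direction (alpha x j i) = - direction (alpha x i j).
Proof.
move=> /neq_pairs[ij]; have [E1 E2] := direction_alpha x ij.
by move=> [[-> ->]|[-> ->]]; rewrite E1 E2 ?opprK.
Qed.

Lemma direction_alpha_continuous {R : realType} {m : nat} (i j : 'I_m) :
  i != j -> continuous (fun x : data R m => direction (alpha x i j)).
Proof.
move=> /neq_pairs[ij [[-> ->]|[-> ->]]].
  rewrite (_ : (fun x => _) = fun x : data R m => direction (x.2 ij)).
    exact: direction_angle_continuous.
  by apply/funext => x; case: (direction_alpha x ij).
rewrite (_ : (fun x => _) = fun x : data R m => - direction (x.2 ij)).
  by move=> x; apply: (@cvgN R (R * R)%type _ (nbhs x)); exact: direction_angle_continuous.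
by apply/funext => x; case: (direction_alpha x ij).
Qed.

Lemma dot_continuous {R : realType} {T : topologicalType} (f g : T -> R * R) :
  continuous f -> continuous g -> continuous (fun t => dot (f t) (g t)).
Proof.
move=> fc gc t.
have c1 (h : T -> R * R) : continuous h -> (h t).1 @[t --> t] --> (h t).1.
  by move=> hc; apply: (@continuous_comp _ _ _ h fst); [exact: hc|exact: cvg_fst].
have c2 (h : T -> R * R) : continuous h -> (h t).2 @[t --> t] --> (h t).2.
  by move=> hc; apply: (@continuous_comp _ _ _ h snd); [exact: hc|exact: cvg_snd].
by apply: cvgD; apply: cvgM; [exact: c1|exact: c1|exact: c2|exact: c2].
Qed.

Lemma norm2_dot {R : realType} (v : R * R) : norm2 v = Num.sqrt (dot v v).
Proof. by rewrite /norm2 /dot -!expr2. Qed.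

Lemma norm2C {R : realType} (v w : R * R) : norm2 (v - w) = norm2 (w - v).
Proof. by rewrite /norm2 -opprB /= !sqrrN. Qed.

Lemma midpoint_continuous {R : realType} {m : nat} (i j : 'I_m) :
  continuous (fun x : data R m => 2^-1 *: (point_of x i + point_of x j)).
Proof.
move=> x; apply: (@cvgZl_tmp R (R * R)%type _ (nbhs x)).
by apply: (@cvgD R (R * R)%type _ (nbhs x)); exact: point_of_continuous.
Qed.

Lemma sdist_continuous_data {R : realType} {m : nat} (i j : 'I_m) (z : R * R) :
  i != j -> continuous (fun x : data R m => sdist x i j z).
Proof.
move=> ij; apply: dot_continuous; first exact: direction_alpha_continuous.
move=> x; apply: (@cvgB R (R * R)%type _ (nbhs x)); first exact: cvg_cst.
exact: midpoint_continuous.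
Qed.

Lemma sdist_continuous {R : realType} {m : nat} (x : data R m) (i j : 'I_m) :
  continuous (sdist x i j).
Proof.
apply: dot_continuous; first by move=> z; exact: cvg_cst.
by move=> z; apply: (@cvgB R (R * R)%type _ (nbhs z)); [exact: cvg_id|exact: cvg_cst].
Qed.

(** * Algebra of the signed distance *)

Lemma sdistC {R : realType} {m : nat} (x : data R m) (i j : 'I_m) (z : R * R) :
  i != j -> sdist x j i z = - sdist x i j z.
Proof.
move=> ij; rewrite /sdist (direction_alphaN x i j ij) [point_of x j + _]addrC.
by rewrite /dot /= !mulNr opprD.
Qed.

(** The direction is a unit vector, so moving along it raises the signed distance at unit rate. *)
Lemma sdist_shift {R : realType} {m : nat} (x : data R m) (i j : 'I_m)
    (z : R * R) (t : R) :
  sdist x i j (z + t *: direction (alpha x i j)) = sdist x i j z + t.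
Proof.
have := dot_direction (alpha x i j); rewrite /sdist /dot.
move: (direction _) (2^-1 *: _) => [d1 d2] [c1 c2] /= dd.
transitivity (d1 * (z.1 - c1) + d2 * (z.2 - c2) + t * (d1 * d1 + d2 * d2)).
  by rewrite /GRing.scale /=; ring.
by rewrite dd mulr1.
Qed.

Lemma sqdist_continuous {R : realType} {m : nat} (z : R * R) (i : 'I_m) :
  continuous (fun x : data R m => sqdist z (point_of x i)).
Proof.
rewrite (_ : (fun x => _) =
    fun x : data R m => dot (z - point_of x i) (z - point_of x i)).
  by apply: dot_continuous => x; apply: (@cvgB R (R * R)%type _ (nbhs x));
    [exact: cvg_cst|exact: point_of_continuous|exact: cvg_cst|
     exact: point_of_continuous].
by apply/funext => x; rewrite /sqdist /dot !expr2.
Qed.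

(** The difference of the two sides is continuous in the data, so its zero set is closed and it
    suffices to treat honest configurations. Where two points have merged both sides vanish, and the
    squared distances no longer determine the sign of [sdist]. *)
Lemma sdistE {R : realType} {m : nat} (x : data R m) (i j : 'I_m) (z : R * R) :
  CDA x -> i != j ->
  2 * norm2 (point_of x j - point_of x i) * sdist x i j z =
  sqdist z (point_of x i) - sqdist z (point_of x j).
Proof.
move=> xC ij; apply/eqP; rewrite -subr_eq0; apply/eqP.
pose h (x : data R m) := 2 * norm2 (point_of x j - point_of x i) *
  sdist x i j z - (sqdist z (point_of x i) - sqdist z (point_of x j)).
have hc : continuous h.
  move=> y; apply: cvgB; last by apply: cvgB; exact: sqdist_continuous.
  apply: cvgM; last exact: sdist_continuous_data.
  apply: cvgM; first exact: cvg_cst.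
  rewrite (_ : (fun x => _) = fun x : data R m =>
    Num.sqrt (dot (point_of x j - point_of x i) (point_of x j - point_of x i))).
    apply: continuous_comp; last exact: sqrt_continuous.
    by apply: dot_continuous => t; apply: (@cvgB R (R * R)%type _ (nbhs t));
      exact: point_of_continuous.
  by apply/funext => t; rewrite norm2_dot.
have hcl : closed (h @^-1` [set r | r = 0]).
  by apply: preimage_closed; [move=> t _; exact: hc|exact: closed_eq].
apply: hcl; apply: closureS xC => y [_ yarg] /=; rewrite /h.
have arg : point_of y j - point_of y i =
    norm2 (point_of y j - point_of y i) *: direction (alpha y i j).
  have [ij' [[-> ->]|[-> ->]]] := neq_pairs i j ij;
    have [E1 E2] := direction_alpha y ij'.
    by rewrite E1; exact: yarg.
  by rewrite E2 scalerN norm2C -opprB; congr (- _); exact: yarg.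
move: arg; set n := norm2 _; rewrite /sdist /sqdist /dot.
move: (direction _) (point_of y i) (point_of y j) => [d1 d2] [p1 p2] [q1 q2].
move=> [e1 e2] /=; rewrite /GRing.scale /=.
move: e1 e2; rewrite /GRing.scale /= => e1 e2.
(* Grouping [n * d1] and [n * d2] lets [e1] and [e2] replace them by the coordinate differences of
   the two points. *)
transitivity (2 * (n * d1 * (z.1 - 2^-1 * (p1 + q1)) +
  n * d2 * (z.2 - 2^-1 * (p2 + q2))) -
  ((z.1 - p1) ^+ 2 + (z.2 - p2) ^+ 2 - ((z.1 - q1) ^+ 2 + (z.2 - q2) ^+ 2))).
  by ring.
by rewrite -e1 -e2; field.
Qed.

(** * Voronoi cells: closedness and covering *)

Lemma voronoi_cellP {R : realType} {m : nat} (x : data R m) (i : 'I_m)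
    (z : R * R) :
  voronoi_cell x i z <-> forall j, j != i -> sdist x i j z <= 0.
Proof. by []. Qed.

Lemma closed_voronoi_cell {R : realType} {m : nat} (x : data R m) (i : 'I_m) :
  closed (voronoi_cell x i).
Proof.
apply: closed_bigI => j _.
apply: (@preimage_closed _ _ (sdist x i j) [set r | r <= 0]).
  by move=> z _; exact: sdist_continuous.
exact: closed_le.
Qed.

(** In an honest configuration the cell of a nearest point contains [z]. The data for which some
    cell contains [z] form a finite union of closed sets, so the property survives in the
    closure. *)
Lemma voronoi_cell_cover {R : realType} {m : nat} (x : data R m.+1)
    (z : R * R) : CDA x -> exists i, voronoi_cell x i z.
Proof.
move=> xC.
pose C (i : 'I_m.+1) := [set y : data R m.+1 | voronoi_cell y i z].
have Ccl : closed (\bigcup_(i in setT) C i).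
  apply: closed_bigcup => [|i _]; first exact: finite_finset.
  apply: closed_bigI => j ji.
  apply: (@preimage_closed _ _ (fun y => sdist y i j z) [set r | r <= 0]).
    by move=> y _; apply: sdist_continuous_data; rewrite eq_sym.
  exact: closed_le.
suff : (\bigcup_(i in setT) C i) x by move=> [i _ Ci]; exists i.
apply: Ccl; apply: closureS xC => y yG.
have [i _ imin] := @arg_minP _ _ _ ord0 predT (fun i => sqdist z (point_of y i)) isT.
exists i => //; apply/voronoi_cellP => j ji.
have ij : i != j by rewrite eq_sym.
have := sdistE y i j z (@subset_closure _ _ _ yG) ij.
(* Points of an honest configuration are distinct, so the factor of [sdist] in [sdistE] can be
   cancelled. *)
have n0 : 0 < norm2 (point_of y j - point_of y i).
  rewrite lt_neqAle norm2_ge0 andbT eq_sym; apply/eqP => /norm2_eq0/eqP.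
  by rewrite subr_eq0; apply/negP; apply: yG.1.
have := imin j isT => /= le E.
rewrite -(pmulr_rle0 _ (_ : 0 < 2 * norm2 (point_of y j - point_of y i))); last lra.
by rewrite E subr_le0.
Qed.

(** * The skeleton in terms of signs of signed distances *)

(** If [A] missed the boundary, [V] would have the same trace on [A] as its interior and as its
    closure. This trace would be open and closed in [A] and contain [a], hence be all of [A]. *)
Lemma connected_boundary {T : topologicalType} (A V : set T) (a b : T) :
  connected A -> A a -> A b -> V a -> ~ V b -> exists2 c, A c & boundary V c.
Proof.
move=> Aco Aa Ab Va Vb; apply: contrapT => nb.
have io c : A c -> closure V c -> interior V c.
  by move=> Ac Vc; apply: contrapT => nV; apply: nb; exists c.
have : A `&` V = A.
  apply: Aco; first by exists a.
  - exists (interior V); first exact: open_interior.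
    apply/seteqP; split=> c [Ac Vc]; split=> //; last exact: interior_subset.
    by apply: io => //; exact: subset_closure.
  - exists (closure V); first exact: closed_closure.
    apply/seteqP; split=> c [Ac Vc]; split=> //; first exact: subset_closure.
    by apply: interior_subset; exact: io.
by move=> /seteqP[_ /(_ b Ab)[]].
Qed.

(** Let [z] lie on the boundary of the cell of [k]. For [i] other than [k], antisymmetry makes [k] a
    witness. For [i = k], if all signed distances were negative they would stay so near [z], and [z]
    would be interior. *)
Lemma skeleton_sdist {R : realType} {m : nat} (x : data R m) (z : R * R) :
  skeleton x z -> forall i, exists2 j, j != i & 0 <= sdist x i j z.
Proof.
move=> [k _ [Vk iVk]] i.
have {}Vk : voronoi_cell x k z by apply: closed_voronoi_cell.
have [ik|ki] := eqVneq k i; last first.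
  exists k => //; rewrite (sdistC x k i z ki) oppr_ge0; apply: (Vk i).
  by rewrite /= eq_sym.
apply: contrapT => nj; apply: iVk; rewrite ik.
rewrite /interior /=; near=> w => j ji; apply: ltW; move: j ji; near: w.
(* There are finitely many indices, so one neighbourhood per [j] is enough. *)
apply: filter_forall => j.
have [->|ji] := eqVneq j i; first by apply: nearW => w /=; rewrite eqxx.
have lt0 : sdist x i j z < 0.
  by rewrite ltNge; apply/negP => le0; apply: nj; exists j.
have := @sdist_continuous R m x i j z _ (lt_nbhsl lt0).
by move=> sd; near=> w => _; near: w; exact: sd.
Unshelve. all: by end_near.
Qed.

Lemma skeleton_near {R : realType} {m : nat} (x : data R m.+1) (z : R * R)
    (s : R) : CDA x -> 0 <= s ->
  (forall i, exists2 j, j != i & - s < sdist x i j z) ->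
  exists2 a, skeleton x a & norm2 (z - a) <= s.
Proof.
move=> xC s0 H; have [i Vi] := voronoi_cell_cover x z xC.
have [j ji Hj] := H i; set d := direction (alpha x i j).
pose path (t : R) := z + t *: d.
have path_c : continuous path.
  move=> t; apply: (@cvgD R (R * R)%type _ (nbhs t)); first exact: cvg_cst.
  by apply: (@cvgZr_tmp R (R * R)%type _ (nbhs t)); exact: cvg_id.
have co : connected (path @` `[0, s]).
  apply: connected_continuous_connected; first exact: segment_connected.
  exact: continuous_subspaceT.
have [c [t]] : exists2 c, (path @` `[0, s]) c & boundary (voronoi_cell x i) c.
  apply: (@connected_boundary _ _ _ (path 0) (path s) co).
  - by exists 0 => //=; rewrite in_itv /= lexx.
  - by exists s => //=; rewrite in_itv /= lexx andbT.
  - by rewrite /path scale0r addr0.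
  (* At time [s] the signed distance exceeds [- s + s = 0], so the endpoint is outside the cell. *)
  - move=> /voronoi_cellP/(_ j ji).
    by rewrite sdist_shift leNgt; apply/negP; rewrite negbK; lra.
rewrite /= in_itv /= => /andP[t0 ts] <- bc; exists (path t); first by exists i.
by rewrite /path opprD addNKr -scaleNr norm2_direction normrN ger0_norm.
Qed.

(** * Lipschitz dependence of signed distances on the data *)

Lemma dist_le_of_derive {R : realType} (f df : R -> R) (x y : R) :
  (forall t : R, is_derive t (1 : R) f (df t)) -> (forall t, `|df t| <= 1) ->
  `|f x - f y| <= `|x - y|.
Proof.
move=> fd df1; wlog yx : x y / y <= x.
  move=> H; case: (leP y x) => [/H //|/ltW/H].
  by rewrite distrC [leRHS]distrC.
have [t _ ->] : exists2 t, t \in `[y, x] & f x - f y = df t * (x - y).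
  apply: MVT_segment => // t; apply: derivable_within_continuous => t0 _.
  exact: ex_derive.
by rewrite normrM ler_piMl.
Qed.

Lemma norm_cos_le1 {R : realType} (x : R) : `|cos x| <= 1.
Proof. by rewrite ler_norml cos_geN1 cos_le1. Qed.

Lemma norm_sin_le1 {R : realType} (x : R) : `|sin x| <= 1.
Proof. by rewrite ler_norml sin_geN1 sin_le1. Qed.

(** Any representative [x] of [a - b] makes [x + repr b] a representative of [a]. As [cos] and [sin]
    are 1-Lipschitz, both differences are lower bounds of the set whose infimum is
    [angle_dist a b]. *)
Lemma direction_dist {R : realType} (a b : angle R) :
  `|(direction a).1 - (direction b).1| <= angle_dist a b /\
  `|(direction a).2 - (direction b).2| <= angle_dist a b.
Proof.
have reprE (c : angle R) : angle_of (repr c) = c by rewrite /angle_of reprK.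
(* Nonemptiness matters: the infimum of the empty set is a default value, unrelated to lower
   bounds. *)
have ne : [set `|x| | x in [set x : R | angle_of x = a - b]] !=set0.
  by exists `|repr (a - b) : R|, (repr (a - b)) => //=.
have aE x : angle_of x = a - b -> a = angle_of (x + repr b).
  by move=> xE; rewrite angle_ofD xE reprE subrK.
split; apply: lb_le_inf => // _ [x /aE -> <-]; rewrite /direction /=.
- rewrite cos_angle_of -[in leRHS](addrK (repr b : R) x).
  apply: (@dist_le_of_derive _ cos (fun t => - sin t)) => t.
  by rewrite normrN norm_sin_le1.
- rewrite sin_angle_of -[in leRHS](addrK (repr b : R) x).
  by apply: (@dist_le_of_derive _ sin cos) => t; exact: norm_cos_le1.
Qed.

Lemma point_dist_le {R : realType} {m : nat} (x y : data R m) (i : 'I_m) :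
  norm2 (point_of x i - point_of y i) <= data_dist x y.
Proof.
rewrite /data_dist le_max; apply/orP; left.
exact: (le_bigmax 0 (fun i => norm2 (point_of x i - point_of y i)) i).
Qed.

Lemma direction_alpha_dist_le {R : realType} {m : nat} (x y : data R m)
    (i j : 'I_m) : i != j ->
  let u := direction (alpha x i j) in let v := direction (alpha y i j) in
  `|u.1 - v.1| <= data_dist x y /\ `|u.2 - v.2| <= data_dist x y.
Proof.
move=> ij u v; rewrite {}/u {}/v.
have le_ad ij' : angle_dist (x.2 ij') (y.2 ij') <= data_dist x y.
  rewrite /data_dist le_max; apply/orP; right.
  exact: (le_bigmax 0 (fun ij => angle_dist (x.2 ij) (y.2 ij)) ij').
have [ij' [[-> ->]|[-> ->]]] := neq_pairs i j ij;
  have [Ex Ex'] := direction_alpha x ij'; have [Ey Ey'] := direction_alpha y ij';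
  have [d1 d2] := direction_dist (x.2 ij') (y.2 ij').
- by rewrite Ex Ey; split; apply: le_trans (le_ad ij').
- by rewrite Ex' Ey' /= -!opprD !normrN; split; apply: le_trans (le_ad ij').
Qed.

Lemma norm_mulB_le {R : realType} (u u' w w' d M : R) :
  `|u - u'| <= d -> `|w - w'| <= d -> `|u'| <= 1 -> `|w| <= M ->
  `|u * w - u' * w'| <= d * (M + 1).
Proof.
move=> du dw u1 wM.
have -> : u * w - u' * w' = (u - u') * w + u' * (w - w') by ring.
rewrite [leRHS]mulrDr mulr1; apply: le_trans (ler_normD _ _) _; rewrite !normrM.
apply: lerD; first by apply: ler_pM.
by rewrite -[leRHS]mul1r; apply: ler_pM.
Qed.

(** Each coordinate contributes one product, estimated by [norm_mulB_le]; hence the factor 2. The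
    bound [M] on the position relative to the midpoint makes the estimate uniform on bounded
    sets. *)
Lemma sdist_dist_le {R : realType} {m : nat} (x y : data R m) (i j : 'I_m)
    (z : R * R) (M : R) : i != j ->
  let w := z - 2^-1 *: (point_of x i + point_of x j) in
  `|w.1| <= M -> `|w.2| <= M ->
  `|sdist x i j z - sdist y i j z| <= 2 * data_dist x y * (M + 1).
Proof.
move=> ij w; rewrite {}/w /sdist /dot.
have [d1 d2] := direction_alpha_dist_le x y i j ij.
have [pi1 pi2] := coord_le_norm2 (point_of x i - point_of y i).
have [pj1 pj2] := coord_le_norm2 (point_of x j - point_of y j).
have li := point_dist_le x y i; have lj := point_dist_le x y j.
move=> w1 w2.
rewrite (_ : 2 * _ * _ =
  data_dist x y * (M + 1) + data_dist x y * (M + 1)); last by ring.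
rewrite opprD addrACA; apply: le_trans (ler_normD _ _) _; apply: lerD.
  apply: norm_mulB_le => //=; last exact: norm_cos_le1.
  (* The midpoint moves by the average of two displacements, each at most [data_dist x y] in every
     coordinate. *)
  move: (le_trans pi1 li) (le_trans pj1 lj); rewrite /= /GRing.scale /= !ler_norml.
  lra.
apply: norm_mulB_le => //=; last exact: norm_sin_le1.
move: (le_trans pi2 li) (le_trans pj2 lj); rewrite /= /GRing.scale /= !ler_norml.
lra.
Qed.

(** * The region far from the disk, controlled by the cameras *)

(** After expansion it suffices that [N ^+ 2 + 2 * (a * p) + 2 * (b * q) < 2 * (a * N)]: the left
    side is below [5 * a], the right side is at least [8 * a]. *)
Lemma far_ineq {R : realType} (N a b p q : R) :
  4 <= N -> N ^+ 2 < a -> `|b| <= a -> `|p| <= 1 -> `|q| <= 1 ->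
  (a - N) ^+ 2 + b ^+ 2 < (a - p) ^+ 2 + (b - q) ^+ 2.
Proof.
move=> N4 Na ba p1 q1.
have a0 : 0 <= a by apply: le_trans ba; exact: normr_ge0.
have ap : a * p <= a.
  by rewrite -[leRHS]mulr1 ler_wpM2l // (le_trans (ler_norm p)).
have bq : b * q <= a.
  apply: le_trans (ler_norm _) _; rewrite normrM -[leRHS]mulr1.
  exact: ler_pM.
have aN : 4 * a <= a * N by rewrite [leRHS]mulrC; exact: ler_wpM2r.
have pp := sqr_ge0 p; have qq := sqr_ge0 q.
have -> : (a - N) ^+ 2 + b ^+ 2 = a ^+ 2 + b ^+ 2 - 2 * (a * N) + N ^+ 2 by ring.
have -> : (a - p) ^+ 2 + (b - q) ^+ 2 =
  a ^+ 2 + b ^+ 2 - 2 * (a * p) - 2 * (b * q) + p ^+ 2 + q ^+ 2 by ring.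
lra.
Qed.

Lemma cameraE {R : realType} (N : R) :
  [/\ camera N (inord 0) = (- N, 0), camera N (inord 1) = (0, N),
      camera N (inord 2) = (N, 0) & camera N (inord 3) = (0, - N)].
Proof. by split; rewrite /camera (tnth_nth 0) inordK. Qed.

Lemma camera_inj {R : realType} (N : R) : 0 < N -> injective (camera N).
Proof.
move=> N0 k l; rewrite /camera !(tnth_nth 0) => kl; apply/val_inj; move: kl.
case: k l => [[|[|[|[|//]]]] _] [[|[|[|[|//]]]] _] //= [] *; exfalso; lra.
Qed.

(** The camera is chosen on the half-axis given by the coordinate of larger modulus and its sign.
    Reflections and exchange of coordinates reduce the four cases to [far_ineq]. *)
Lemma far_camera {R : realType} (N : R) (z : R * R) : 4 <= N ->
  N ^+ 2 < `|z.1| \/ N ^+ 2 < `|z.2| ->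
  exists k, forall p, norm2 p <= 1 -> sqdist z (camera N k) < sqdist z p.
Proof.
move=> N4 far; have [c0 c1 c2 c3] := cameraE N.
have coord p : norm2 p <= 1 -> `|p.1| <= 1 /\ `|p.2| <= 1.
  by move=> p1; have [? ?] := coord_le_norm2 p; split; apply: le_trans p1.
case: (leP `|z.2| `|z.1|) => z21.
- have far1 : N ^+ 2 < `|z.1| by case: far => // /lt_le_trans/(_ z21).
  case: (leP 0 z.1) => z0.
  + have zE : `|z.1| = z.1 by rewrite ger0_norm.
    rewrite zE in z21 far1. exists (inord 2); move=> p /coord[p1 p2].
    rewrite c2 /sqdist /= subr0; exact: far_ineq.
  + have zE : `|z.1| = - z.1 by rewrite ltr0_norm.
    rewrite zE in z21 far1. exists (inord 0); move=> p /coord[p1 p2].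
    rewrite c0 /sqdist /= subr0 -(sqrrN (z.1 - - N)) -(sqrrN (z.1 - p.1)).
    rewrite !opprD !opprK -[p.1]opprK; apply: far_ineq => //; by rewrite normrN.
- have far2 : N ^+ 2 < `|z.2| by case: far => // /lt_trans/(_ z21).
  case: (leP 0 z.2) => z0.
  + have zE : `|z.2| = z.2 by rewrite ger0_norm.
    rewrite zE in z21 far2. exists (inord 1); move=> p /coord[p1 p2].
    rewrite c1 /sqdist /= subr0 addrC [ltRHS]addrC; apply: far_ineq => //.
    exact: ltW.
  + have zE : `|z.2| = - z.2 by rewrite ltr0_norm.
    rewrite zE in z21 far2. exists (inord 3); move=> p /coord[p1 p2].
    rewrite c3 /sqdist /= subr0 addrC [ltRHS]addrC.
    rewrite -(sqrrN (z.2 - - N)) -(sqrrN (z.2 - p.2)).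
    rewrite !opprD !opprK -[p.2]opprK; apply: far_ineq => //;
      by rewrite ?normrN // ltW.
Qed.

Lemma sdist_ge0 {R : realType} {m : nat} (x : data R m) (i j : 'I_m)
    (z : R * R) : CDA x -> i != j -> point_of x i != point_of x j ->
  sqdist z (point_of x j) <= sqdist z (point_of x i) -> 0 <= sdist x i j z.
Proof.
move=> xC ij pij le.
rewrite -(pmulr_rge0 _ (_ : 0 < 2 * norm2 (point_of x j - point_of x i))).
  by rewrite sdistE // subr_ge0.
rewrite mulr_gt0 // lt_neqAle norm2_ge0 andbT eq_sym; apply/eqP => /norm2_eq0/eqP.
by rewrite subr_eq0 eq_sym; apply/negP.
Qed.

Lemma sdist_ge0_le {R : realType} {m : nat} (x : data R m) (i j : 'I_m)
    (z : R * R) : CDA x -> i != j -> 0 <= sdist x i j z ->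
  sqdist z (point_of x j) <= sqdist z (point_of x i).
Proof.
move=> xC ij s0; rewrite -subr_ge0 -sdistE // mulr_ge0 // mulr_ge0 //.
exact: norm2_ge0.
Qed.

(** For a disk point the near camera [k] is a witness. For a camera, the witness supplied by [x] is
    kept if it is a camera; if it is a disk point, [k] is nearer still and replaces it. *)
Lemma skeleton_far {R : realType} {n : nat} (N : R) (x y : data R (4 + n))
    (z : R * R) : 4 <= N -> CDA_U N x -> CDA_U N y ->
  N ^+ 2 < `|z.1| \/ N ^+ 2 < `|z.2| -> skeleton x z ->
  forall i, exists2 j, j != i & 0 <= sdist y i j z.
Proof.
move=> N4 [xC xc xp] [yC yc yp] far /skeleton_sdist Sz i.
have N0 : 0 < N by lra.
have [k kmin] := far_camera N z N4 far.
have sd_gt l : l != lshift n k ->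
    sqdist z (camera N k) < sqdist z (point_of y l) -> 0 <= sdist y l (lshift n k) z.
  move=> lk lt; apply: sdist_ge0 => //; last by rewrite yc ltW.
  (* The strict inequality forces the two points apart, as [sdist_ge0] requires. *)
  by apply: contraTneq lt => ->; rewrite yc ltxx.
case: (split_ordP i) => [c ->|p ->]; last first.
  by exists (lshift n k); rewrite ?eq_lrshift //; apply: sd_gt; rewrite ?eq_rlshift ?kmin.
have [j ji] := Sz (lshift n c); case: (split_ordP j) ji => [c' ->|p ->] ji sj.
- exists (lshift n c') => //.
  have cc' : lshift n c != lshift n c' by rewrite eq_sym.
  apply: sdist_ge0 => //.
    rewrite !yc; apply: contraNneq cc' => /(camera_inj N N0) ->; exact: eqxx.
  (* The comparison of squared distances transfers because [x] and [y] have the same cameras. *)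
  by rewrite !yc -!xc; apply: sdist_ge0_le.
- have lt : sqdist z (camera N k) < sqdist z (camera N c).
    apply: lt_le_trans (kmin _ (xp p)) _; rewrite -xc; apply: sdist_ge0_le => //.
    by rewrite eq_sym.
  have ck : lshift n c != lshift n k.
    by apply: contraTneq lt => /lshift_inj ->; rewrite ltxx.
  by exists (lshift n k); [rewrite eq_sym|apply: sd_gt; rewrite ?yc].
Qed.

(** * Comparison of two skeletons *)

(** One half of the Hausdorff estimate; exchanging [x] and [y] gives the other. *)
Lemma skeleton_approx {R : realType} {n : nat} (N s : R)
    (x y : data R (4 + n)) :
  4 <= N -> CDA_U N x -> CDA_U N y -> 0 < s ->
  (forall i j z, i != j -> `|z.1| <= N ^+ 2 -> `|z.2| <= N ^+ 2 ->
     `|sdist x i j z - sdist y i j z| < s) ->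
  forall z, skeleton x z -> exists2 a, skeleton y a & norm2 (z - a) <= s.
Proof.
move=> N4 xU yU s0 close z Sz; have yC : CDA y by case: yU.
apply: (@skeleton_near R (3 + n) y z s yC (ltW s0)) => i.
have [near|far] : (`|z.1| <= N ^+ 2 /\ `|z.2| <= N ^+ 2) \/
    (N ^+ 2 < `|z.1| \/ N ^+ 2 < `|z.2|).
- have [z1|z1] := leP `|z.1| (N ^+ 2); last by right; left.
  by have [z2|z2] := leP `|z.2| (N ^+ 2); [left|right; right].
- have [j ji sj] := skeleton_sdist x z Sz i; exists j => //.
  have := close i j z; rewrite eq_sym => /(_ ji near.1 near.2).
  by rewrite ltr_norml => /andP[_]; lra.
- have [j ji sj] := skeleton_far N x y z N4 xU yU far Sz i; exists j => //.
  by apply: lt_le_trans sj; rewrite oppr_lt0.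
Qed.

Lemma data_coord_le {R : realType} {n : nat} (N : R) (x : data R (4 + n))
    (i : 'I_(4 + n)) :
  1 <= N -> CDA_U N x -> `|(point_of x i).1| <= N /\ `|(point_of x i).2| <= N.
Proof.
move=> N1 [_ xc xp]; have N0 : 0 <= N by lra.
case: (split_ordP i) => [c ->|p ->].
  rewrite xc /camera (tnth_nth 0).
  by case: c => [[|[|[|[|//]]]] _] /=; rewrite ?normrN normr0 ger0_norm.
by have [? ?] := coord_le_norm2 (point_of x (rshift 4 p)); split;
  apply: le_trans N1; apply: le_trans (xp p).
Qed.

Theorem theorem6p11 (R : realType) (N : R) (hN : 2 + 2 * Num.sqrt 2 < N)
    (n : nat) (gamma : data R (4 + n)) (hgamma : CDA_U N gamma)
    (eps : R) (heps : 0 < eps) :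
  exists delta : R, 0 < delta /\
    forall eta : data R (4 + n), CDA_U N eta ->
      data_dist gamma eta <= delta ->
      (hausdorff_dist (skeleton gamma) (skeleton eta) <= eps%:E)%E.
Proof.
have sqrt2 : 1 <= Num.sqrt 2 :> R by rewrite -[leLHS]sqrtr1 ler_wsqrtr // ler1n.
have N4 : 4 <= N by lra.
have [N0 N1] : 0 <= N /\ 1 <= N by lra.
(* Bounds the coordinates of [z] minus a midpoint: [N ^+ 2] from the square, [N] from the data
   points. *)
pose M := N ^+ 2 + N.
have M0 : 0 < M + 1 by rewrite /M; have := sqr_ge0 N; lra.
(* The bound of [sdist_dist_le] becomes at most [eps / 4], strictly below the [eps / 2] wanted in
   [close]. *)
exists (eps / (8 * (M + 1))); split; first by rewrite divr_gt0 // mulr_gt0.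
move=> eta heta dle.
have close i j z : i != j -> `|z.1| <= N ^+ 2 -> `|z.2| <= N ^+ 2 ->
    `|sdist gamma i j z - sdist eta i j z| < eps / 2.
  move=> ij z1 z2.
  have [i1 i2] := data_coord_le N gamma i N1 hgamma.
  have [j1 j2] := data_coord_le N gamma j N1 hgamma.
  apply: (@le_lt_trans _ _ (2 * data_dist gamma eta * (M + 1))).
    apply: sdist_dist_le => //=; rewrite /GRing.scale /= /M; move: z1 z2 i1 i2 j1 j2;
      rewrite !ler_norml; lra.
  have := ler_wpM2r (ltW M0) dle.
  rewrite (_ : eps / (8 * (M + 1)) * (M + 1) = eps / 8); last by field; lra.
  lra.
have e2 : 0 < eps / 2 by lra.
(* Approximation within [eps / 2] gives the strict inequality in [nbhd], so the radius [eps] itself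
   is admissible. *)
apply: ereal_inf_lbound; exists eps => //; split=> // z Sz.
- have [a Sa az] := skeleton_approx N _ gamma eta N4 hgamma heta e2 close z Sz.
  by exists a => //; apply: le_lt_trans az _; lra.
- have close' i j z' : i != j -> `|z'.1| <= N ^+ 2 -> `|z'.2| <= N ^+ 2 ->
      `|sdist eta i j z' - sdist gamma i j z'| < eps / 2.
    by rewrite distrC; exact: close.
  have [a Sa az] := skeleton_approx N _ eta gamma N4 heta hgamma e2 close' z Sz.
  by exists a => //; apply: le_lt_trans az _; lra.
Qed.
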